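(* Let $N\ge 1$, $\lambda_1,\dots,\lambda_N>0$ and $0<B<N$. Let $T>0$ be the FIFO characteristic time, i.e. the unique solution of $\sum_{i=1}^N\bigl(1-\frac{1}{1+\lambda_iT}\bigr)=B$. For $h\in(0,1)$ define \[ U_i(h)=\lambda_i(\log h-h),\qquad i=1,\dots,N . \] Then $U_i'(h)=\frac{\lambda_i}{h}-\lambda_i$, and for every $\alpha>0$, $(U_i')^{-1}(\alpha)=1-\frac{1}{1+\lambda_i/\alpha}$. Moreover, the optimal solution of \[ \text{maximize } \sum_{i=1}^N U_i(h_i)\quad\text{such that}\quad \sum_{i=1}^N h_i=B,\quad 0<h_i<1,\ i=1,\dots,N, \] is given by the FIFO hit probabilities $h_i=1-\frac{1}{1+\lambda_iT}$, $i=1,\dots,N$, and the Lagrange multiplier $\alpha$ of the constraint $\sum_i h_i=B$ (the number with $U_i'(h_i)=\alpha$ for all $i$ at the optimum) satisfies $T=1/\alpha$.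
   Context: Requests for file $i$ arrive at a cache of size $B$ as a Poisson process of rate $\lambda_i$. The FIFO policy is identified with its characteristic-time description: the hit probability of file $i$ is $h_i=1-\frac{1}{1+\lambda_iT}$, where the characteristic time $T$ is determined by $\sum_i h_i=B$. The Lagrangian of the maximization problem is $\mathcal{L}(\mathbf{h},\alpha)=\sum_{i}U_i(h_i)-\alpha\bigl[\sum_i h_i-B\bigr]$. *)

(* Defs.v *)
From mathcomp Require Import all_boot all_order all_algebra.
From mathcomp Require Import all_classical all_reals all_analysis.

Set Implicit Arguments.
Unset Strict Implicit.
Unset Printing Implicit Defensive.

Import Order.TTheory GRing.Theory Num.Theory.
Import numFieldNormedType.Exports.

Local Open Scope ring_scope.

Definition fifo_hit (R : realType) (N : nat) (lam : 'I_N -> R) (T : R)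
    (i : 'I_N) : R :=
  1 - 1 / (1 + lam i * T).

Definition fifo_characteristic_time (R : realType) (N : nat)
    (lam : 'I_N -> R) (B T : R) : Prop :=
  0 < T /\ \sum_(i < N) fifo_hit lam T i = B.

(* Only the values on the open interval (0, 1) are meaningful. *)
Definition fifo_utility (R : realType) (N : nat) (lam : 'I_N -> R)
    (i : 'I_N) (h : R) : R :=
  lam i * (ln h - h).

Definition feasible (R : realType) (N : nat) (B : R) (h : 'I_N -> R) : Prop :=
  \sum_(i < N) h i = B /\ forall i, 0 < h i < 1.

Definition total_utility (R : realType) (N : nat) (U : 'I_N -> R -> R)
    (h : 'I_N -> R) : R :=
  \sum_(i < N) U i (h i).

Definition optimal_solution (R : realType) (N : nat) (U : 'I_N -> R -> R)
    (B : R) (h : 'I_N -> R) : Prop :=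
  feasible B h /\
  forall g, feasible B g -> total_utility U g <= total_utility U h.

Definition lagrangian (R : realType) (N : nat) (U : 'I_N -> R -> R) (B : R)
    (h : 'I_N -> R) (alpha : R) : R :=
  total_utility U h - alpha * (\sum_(i < N) h i - B).

(* Every partial derivative of the Lagrangian in h exists and vanishes at h;
   [dfwith h i x] is h with its i-th coordinate replaced by x. *)
Definition lagrange_multiplier (R : realType) (N : nat) (U : 'I_N -> R -> R)
    (B : R) (h : 'I_N -> R) (alpha : R) : Prop :=
  forall i : 'I_N,
    is_derive (h i) (1 : R)
      (fun x : R => lagrangian U B (dfwith h i x) alpha) (0 : R).

(* Main.v *)
Require Import Defs.
From mathcomp Require Import all_boot all_order all_algebra.
From mathcomp Require Import all_classical all_reals all_analysis.
From mathcomp Require Import ring.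
Import Order.TTheory GRing.Theory Num.Theory.
Import numFieldNormedType.Exports.
Local Open Scope ring_scope.

(** The marginal utility of file i at its FIFO hit probability
    lam_i T / (1 + lam_i T) is 1 / T, the same for all files.  By strict
    concavity of ln, U_i lies strictly below its tangent at that point except
    at the point itself.  The tangents share the slope 1 / T, so their linear
    terms cancel in the sum over the constraint plane. *)

(** This is [1 + u < expR u] for [u != 0], taken at [u = ln (y / x)]. The [leif] form keeps the
    equality case, from which uniqueness of the maximizer follows. *)
Lemma ln_le_tangent (R : realType) (x y : R) : 0 < x -> 0 < y ->
  ln y <= ln x + (y - x) / x ?= iff (y == x).
Proof.
move=> x0 y0; have xn0 : x != 0 by rewrite gt_eqF.
case: (eqVneq y x) => [->|yx].
  by apply/leifP; rewrite subrr mul0r addr0.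
apply/leifP; rewrite -ltrBlDl -ln_div ?posrE//.
have yx0 : 0 < y / x by rewrite divr_gt0.
have lnyx : ln (y / x) != 0.
  rewrite ln_eq0// -subr_eq0 -[X in _ - X](divff xn0) -mulrBl.
  by rewrite mulf_neq0 ?invr_eq0 ?subr_eq0.
have := expR_gt1Dx lnyx; rewrite lnK ?posrE//.
by rewrite mulrBl divff// ltrBrDl.
Qed.

Section FifoHit.
Context {R : realType} {N : nat} {lam : 'I_N -> R}.
Context (lam_gt0 : forall i, 0 < lam i).

Lemma lam_neq0 i : lam i != 0. Proof. by rewrite gt_eqF. Qed.

Lemma fifo_denom_gt0 (T : R) i : 0 <= T -> 0 < 1 + lam i * T.
Proof. by move=> T0; rewrite ltr_pwDl// mulr_ge0// ltW. Qed.

Lemma fifo_hit_itv (T : R) i : 0 < T -> 0 < fifo_hit lam T i < 1.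
Proof.
move=> T0; have lT : 0 < lam i * T by rewrite mulr_gt0.
have d0 := fifo_denom_gt0 T i (ltW T0).
rewrite /fifo_hit div1r subr_gt0 invf_lt1// ltrDl lT/=.
by rewrite ltrBlDr ltrDl invr_gt0.
Qed.

Lemma fifo_hit_lt (S T : R) i : 0 <= S -> S < T ->
  fifo_hit lam S i < fifo_hit lam T i.
Proof.
move=> S0 ST; rewrite /fifo_hit ltrD2l ltrN2 !div1r ltf_pV2.
- by rewrite ltrD2l ltr_pM2l.
- by rewrite posrE fifo_denom_gt0// (le_trans S0)// ltW.
- by rewrite posrE fifo_denom_gt0.
Qed.

(** The denominator is still positive at time 0, so the domain can include the endpoint where the
    intermediate value argument starts. *)
Lemma fifo_hit_continuous i : {in `[0, +oo[%classic,
  continuous (fun T : R => fifo_hit lam T i)}.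
Proof.
move=> T; rewrite inE/= in_itv/= andbT => T0.
rewrite /fifo_hit; apply: cvgB; first exact: cvg_cst.
apply: cvgM; first exact: cvg_cst.
apply: cvgV; first by rewrite gt_eqF// fifo_denom_gt0.
by apply: cvgD; [exact: cvg_cst|apply: cvgM; [exact: cvg_cst|exact: cvg_id]].
Qed.

(** Each hit probability increases strictly with time, and so does their sum once there is at least
    one file. *)
Lemma fifo_characteristic_time_unique (B S T : R) : (0 < N)%N ->
  fifo_characteristic_time lam B S -> fifo_characteristic_time lam B T ->
  S = T.
Proof.
move=> N0 [S0 hS] [T0 hT].
have lt_sum (V W : R) : 0 < V -> V < W ->
    \sum_(i < N) fifo_hit lam V i < \sum_(i < N) fifo_hit lam W i.
  move=> V0 VW; apply: ltr_sum => [|i _]; last exact: fifo_hit_lt (ltW V0) VW.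
  by apply/hasP; exists (Ordinal N0); rewrite ?mem_index_enum.
case: (ltgtP S T) => // [/(lt_sum _ _ S0)|/(lt_sum _ _ T0)];
  by rewrite hS hT ltxx.
Qed.

(** Intermediate value theorem: the total hit probability is continuous, vanishes at time 0 and is
    at least [B] at an explicit time [M]. *)
Lemma fifo_characteristic_time_exists (B : R) : 0 < B < N%:R ->
  exists T, fifo_characteristic_time lam B T.
Proof.
move=> /andP[B0 BN].
have N0 : (0 < N)%N by rewrite -(ltr0n R) (lt_trans B0).
have NB : 0 < N%:R - B by rewrite subr_gt0.
pose s := \sum_(i < N) (lam i)^-1.
have s0 : 0 < s.
  rewrite /s (bigD1 (Ordinal N0))//= ltr_pwDl ?invr_gt0//.
  by apply: sumr_ge0 => i _; rewrite invr_ge0 ltW.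
(* The bound hit_i >= 1 - 1 / (lam_i M) sums to N - s / M, which is B. *)
pose M := s / (N%:R - B).
have M0 : 0 < M by rewrite divr_gt0.
pose f (T : R) := \sum_(i < N) fifo_hit lam T i.
have f0 : f 0 = 0.
  by rewrite /f big1// => i _; rewrite /fifo_hit mulr0 addr0 divr1 subrr.
have fM : B <= f M.
  have -> : B = \sum_(i < N) (1 - (lam i)^-1 / M).
    rewrite sumrB sumr_const card_ord -mulr_suml -/s /M.
    by field; rewrite ?gt_eqF.
  apply: ler_sum => i _; rewrite /fifo_hit lerD2l lerN2 div1r -invfM.
  have lM : 0 < lam i * M by exact: mulr_gt0.
  rewrite lef_pV2 ?posrE//; first by rewrite lerDr.
  exact: fifo_denom_gt0 (ltW M0).
have cf : {within `[0, M], continuous f}%classic.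
  apply: continuous_in_subspaceT => T /set_mem/=; rewrite in_itv/= => /andP[T0 _].
  rewrite /continuous_at /f.
  apply: cvg_big => [|i _]; first exact: add_continuous.
  by apply: fifo_hit_continuous; rewrite inE/= in_itv/= T0.
have [|T /[!in_itv]/= /andP[T0 _] fT] := IVT (v := B) (ltW M0) cf.
  by rewrite f0 ge_min le_max (ltW B0) fM orbT.
(* The theorem only yields [0 <= T]; time 0 is excluded because the total there is 0 while
   [0 < B]. *)
exists T; split=> //; rewrite lt_neqAle T0 andbT.
by apply: contraTneq B0 => T_eq; rewrite -fT -T_eq f0 ltxx.
Qed.

Lemma fifo_utility_is_derive i (h : R) : 0 < h ->
  is_derive h (1 : R) (fifo_utility lam i) (lam i / h - lam i).
Proof.
move=> h0; have dln := is_derive1_ln h0.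
have := is_deriveZ (lam i) (is_deriveB dln (is_derive_id h (1 : R))).
by move=> /is_derive_eq; apply; rewrite /GRing.scale/= mulrBr mulr1.
Qed.

Lemma fifo_utility_derive1 i (h : R) : 0 < h ->
  derive1 (fifo_utility lam i) h = lam i / h - lam i.
Proof.
move=> h0; have dU := fifo_utility_is_derive i h h0.
by rewrite derive1E derive_val.
Qed.

Lemma fifo_marginal_utility (T : R) i : 0 < T ->
  lam i / fifo_hit lam T i - lam i = T^-1.
Proof.
move=> T0; have d0 := fifo_denom_gt0 T i (ltW T0).
have -> : fifo_hit lam T i = lam i * T / (1 + lam i * T).
  by rewrite /fifo_hit; field; rewrite gt_eqF.
by field; rewrite !gt_eqF.
Qed.

(** The preimage of [a] is the FIFO hit probability at time [a^-1], where the marginal utility is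
    [a]; injectivity is that of inversion. *)
Lemma fifo_utility_derive1_bij i :
  set_bij `]0, 1[%classic `]0, +oo[%classic (derive1 (fifo_utility lam i)).
Proof.
split=> [h|h k|a]/=.
- rewrite !in_itv/= => /andP[h0 h1]; rewrite fifo_utility_derive1// andbT.
  by rewrite subr_gt0 ltr_pdivlMr// gtr_pMr.
- rewrite !inE/= !in_itv/= => /andP[h0 _] /andP[k0 _].
  rewrite !fifo_utility_derive1// => /addIr.
  by move/(mulfI (lam_neq0 i))/invr_inj.
- rewrite in_itv/= andbT => a0; have a'0 : 0 < a^-1 by rewrite invr_gt0.
  have /andP[h0 h1] := fifo_hit_itv _ i a'0.
  exists (fifo_hit lam a^-1 i); first by rewrite /= in_itv/= h0.
  by rewrite fifo_utility_derive1// fifo_marginal_utility// invrK.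
Qed.

(** The default [fun=> 0] concerns only points outside the image of the derivative; by the
    bijection, every positive [a] lies inside it. *)
Lemma fifo_utility_derive1_pinv i (a : R) : 0 < a ->
  'pinv_(fun=> 0) `]0, 1[%classic (derive1 (fifo_utility lam i)) a =
  1 - 1 / (1 + lam i / a).
Proof.
move=> a0; have a'0 : 0 < a^-1 by rewrite invr_gt0.
have /andP[h0 h1] := fifo_hit_itv _ i a'0.
have {1}-> : a = derive1 (fifo_utility lam i) (fifo_hit lam a^-1 i).
  by rewrite fifo_utility_derive1// fifo_marginal_utility// invrK.
have [_ inj _] := fifo_utility_derive1_bij i.
by rewrite pinvKV// inE/= in_itv/= h0.
Qed.

Lemma fifo_hit_optimal (B T : R) (h : 'I_N -> R) :
  fifo_characteristic_time lam B T ->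
  optimal_solution (fifo_utility lam) B h <-> h =1 fifo_hit lam T.
Proof.
move=> [T0 sumT]; set U := fifo_utility lam; set hT := fifo_hit lam T.
have fT : feasible B hT by split=> // i; exact: fifo_hit_itv.
have below g : feasible B g ->
    total_utility U g <= total_utility U hT ?= iff [forall i, g i == hT i].
  move=> [sumg g01].
  have -> : total_utility U hT = \sum_(i < N) (U i (hT i) + (g i - hT i) / T).
    by rewrite big_split/= -mulr_suml sumrB sumg sumT subrr mul0r addr0.
  apply: leif_sum => i _.
  have /andP[g0 _] := g01 i; have /andP[h0 _] := fifo_hit_itv T i T0.
  (* Writing [T^-1] as [lam i / hT i - lam i] cancels the terms linear in [hT i]; what remains to
     prove is the tangent bound for [ln] at [hT i], scaled by [lam i]. *)
  have -> : U i (hT i) + (g i - hT i) / T =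
      lam i * (ln (hT i) + (g i - hT i) / hT i - g i).
    rewrite -(fifo_marginal_utility T i T0) -/(hT i) /U /fifo_utility.
    by field; rewrite gt_eqF.
  rewrite /U /fifo_utility (mono_leif (ler_pM2l (lam_gt0 i))) leifBLR subrK.
  exact: ln_le_tangent.
split=> [[fh oh]|/funext ->].
  (* An optimal [h] reaches the value at [hT], so the equality case of [below] identifies them file
     by file. *)
  have [le_h eq_h] := below h fh.
  move: eq_h; rewrite eq_le le_h (oh _ fT) => /esym/forallP hE i.
  exact/eqP.
by split=> // g /below[].
Qed.

(** As a function of coordinate [i] alone, the Lagrangian is [U i x - a * x] plus the constant [c],
    so stationarity says that the marginal utility equals [a]. *)
Lemma lagrange_multiplier_fifoE (B : R) (h : 'I_N -> R) (a : R) :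
  (forall i, 0 < h i) ->
  lagrange_multiplier (fifo_utility lam) B h a <->
  forall i, lam i / h i - lam i = a.
Proof.
move=> h0; set U := fifo_utility lam.
have dL i : is_derive (h i) (1 : R)
    (fun x => lagrangian U B (dfwith h i x) a) (lam i / h i - lam i - a).
  pose c := \sum_(j < N | j != i) U j (h j)
    - a * (\sum_(j < N | j != i) h j - B).
  have -> : (fun x => lagrangian U B (dfwith h i x) a) =
      U i - a \*: id + cst c.
    apply/funext => x; rewrite /lagrangian /total_utility.
    rewrite (bigD1 i)//= [in X in _ - X](bigD1 i)//= dfwithin.
    under eq_bigr => j ji do rewrite dfwithout 1?eq_sym//.
    under [in X in _ - X]eq_bigr => j ji do rewrite dfwithout 1?eq_sym//.
    by rewrite /c !fctE -[(_ \*: _) _]/(a * x); ring.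
  have dU := fifo_utility_is_derive i (h i) (h0 i).
  have daid := is_deriveZ a (is_derive_id (h i) (1 : R)).
  have dsum := is_deriveD (is_deriveB dU daid) (is_derive_cst c (h i) 1).
  apply: is_derive_eq dsum _.
  by rewrite addr0 -[_ *: _]/(a * 1) mulr1.
split=> [ha i|ha i].
  have dLi := dL i; have dL0 := ha i.
  by apply/eqP; rewrite -subr_eq0 -(@derive_val _ _ _ _ _ _ _ dLi) derive_val.
by apply: is_derive_eq (dL i) _; rewrite ha subrr.
Qed.

End FifoHit.

Theorem mainTheorem2 (R : realType) (N : nat) (lam : 'I_N -> R) (B : R)
    (hN : (1 <= N)%N) (hlam : forall i, 0 < lam i) (hB : 0 < B < N%:R) :
  let U := fifo_utility lam in
  [/\ exists! T : R, fifo_characteristic_time lam B T,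
      forall (i : 'I_N) (h : R), 0 < h < 1 ->
        is_derive h (1 : R) (U i) (lam i / h - lam i),
      forall i : 'I_N,
        set_bij `]0, 1[%classic `]0, +oo[%classic (derive1 (U i)) /\
        (forall alpha : R, 0 < alpha ->
           'pinv_(fun=> 0) `]0, 1[%classic (derive1 (U i)) alpha
             = 1 - 1 / (1 + lam i / alpha))
    & forall T : R, fifo_characteristic_time lam B T ->
        let hT := fifo_hit lam T in
        [/\ forall h : 'I_N -> R, optimal_solution U B h <-> h =1 hT,
            exists! alpha : R, lagrange_multiplier U B hT alpha,
            forall alpha : R, lagrange_multiplier U B hT alpha <->
              (forall i, derive1 (U i) (hT i) = alpha)
          & forall alpha : R, lagrange_multiplier U B hT alpha ->
              T = 1 / alpha]].
Proof.
move=> U; split.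
- have [T hT] := fifo_characteristic_time_exists hlam B hB.
  by exists T; split=> // S; exact: fifo_characteristic_time_unique.
- by move=> i h /andP[h0 _]; exact: fifo_utility_is_derive.
- move=> i; split; first exact: fifo_utility_derive1_bij.
  exact: fifo_utility_derive1_pinv.
- move=> T ctT hT; have [T0 _] := ctT.
  have h0 i : 0 < hT i by have /andP[] := fifo_hit_itv hlam T i T0.
  (* Stationarity at any single file already forces the value [T^-1]; [hN] supplies such a file. *)
  have multE a : lagrange_multiplier U B hT a <-> a = T^-1.
    rewrite (lagrange_multiplier_fifoE B hT a h0).
    split=> [/(_ (Ordinal hN)) <-|-> i]; exact: fifo_marginal_utility.
  split.
  + by move=> h; exact: fifo_hit_optimal.
  + by exists T^-1; split=> [|a]; rewrite multE.
  + move=> a; rewrite (lagrange_multiplier_fifoE B hT a h0).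
    by split=> ha i; have := ha i; rewrite fifo_utility_derive1.
  + by move=> a; rewrite multE => ->; rewrite div1r invrK.
Qed.
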